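(* The product $[0,1] \times \omega$ has the Uniquely Universal property (UU). That is, there exists an open set $U \subseteq [0,1] \times \omega$ such that for every open set $W \subseteq \omega$ there is exactly one $x \in [0,1]$ with $U(x) = W$.
   Context: For topological spaces $X$ and $Y$, a set $A \subseteq X \times Y$ and $x \in X$, write $A(x) = \{y \in Y : (x,y) \in A\}$ for the cross section of $A$ at $x$. The product $X \times Y$ satisfies the Uniquely Universal property (UU) iff there exists an open set $U \subseteq X \times Y$ such that for every open set $W \subseteq Y$ there is a unique $x \in X$ with $U(x) = W$; such a $U$ is called a UU set for $X \times Y$. Here $[0,1]$ carries its usual topology, $\omega = \{0,1,2,\dots\}$ carries the discrete topology (so every subset of $\omega$ is open), and $[0,1] \times \omega$ carries the product topology. *)

(* Defs.v *)
From mathcomp Require Import all_boot all_order all_algebra.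
From mathcomp Require Import all_classical all_reals all_analysis.

Set Implicit Arguments.
Unset Strict Implicit.
Unset Printing Implicit Defensive.

Import numFieldNormedType.Exports.

Local Open Scope classical_set_scope.

(* [xsection U x] is the cross section U(x) = {y | (x, y) \in U}. *)
Definition UU_set (X Y : topologicalType) (U : set (X * Y)) : Prop :=
  open U /\ forall W : set Y, open W -> exists! x : X, xsection U x = W.

Definition UU (X Y : topologicalType) : Prop :=
  exists U : set (X * Y), UU_set U.

(* As a type, a set carries the initial topology of its inclusion, so this is
   [0, 1] with its usual topology. *)
Definition unit_interval (R : realType) : topologicalType :=
  set_type (`[0%R, 1%R]%classic : set R).

(* Main.v *)
Require Import Defs.
From mathcomp Require Import all_boot all_order all_algebra.
From mathcomp Require Import all_classical all_reals all_analysis.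
From mathcomp Require Import finmap.
From mathcomp Require Import lra.

(** Since [nat] is discrete, an open subset of [[0, 1] * nat] amounts to a
    sequence of open sets [U_n] in [[0, 1]], and it is uniquely universal when
    [x |-> {n | x \in U_n}] is a bijection onto the subsets of [nat].

    The itinerary of [x] under the tent map [T], that is
    [{n | 1/2 < T^n x}], comes close.  Its level sets are open because [T] is
    continuous.  It is injective because two points which always stay on the
    same side of [1/2] are pulled apart by a factor 2 at every step.  By
    compactness, each set [W] is a weak itinerary of some [x]: [1/2 <= T^n x]
    for [n] in [W] and [T^n x <= 1/2] otherwise.  If [T^n x] never equals
    [1/2], then [W] is the itinerary of [x].  If [T^n x = 1/2], then the
    orbit goes on [1, 0, 0, ...], and [W] is finite.  So the only sets which
    can be missed are finite ([tent_itinerary_surj]).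

    The missed sets are recovered by a Hilbert hotel argument
    ([UU_of_injection]).  Each missed set [d] starts a chain
    [d = W_0 < W_1 < W_2 < ...] of sets, infinite from [W_1] on and hence
    attained; the point sent to [W_(i+1)] is sent to [W_i] instead.  This
    only removes numbers from the value at a point, and the increments of all
    the chains can be taken in pairwise disjoint blocks.  A given [n] is then
    removed at no more than one point, so that [U_n] loses at most one point
    and remains open. *)

Set Implicit Arguments.
Unset Strict Implicit.
Unset Printing Implicit Defensive.

Import Order.TTheory GRing.Theory Num.Theory.
Import numFieldNormedType.Exports.

Local Open Scope classical_set_scope.

(** * Chains above finite sets *)

(** For fixed [d] and [a], the labels form the infinite block of numbers which
    the chain above [d] gains at step [a]. *)
Definition label (d : set nat) (a b : nat) : nat :=
  @choice.pickle ({fset nat} * nat * nat)%type (fset_set d, a, b).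

(** Distinct blocks, even above distinct finite sets, are disjoint. *)
Lemma label_inj d d' a a' b b' : finite_set d -> finite_set d' ->
  label d a b = label d' a' b' -> [/\ d = d', a = a' & b = b'].
Proof.
by move=> fd fd' /(pcan_inj (@choice.pickleK _))[/(fset_set_inj fd fd') ? ? ?].
Qed.

Definition chain (d : set nat) (i : nat) : set nat :=
  d `|` [set n | exists a b, (a < i)%N /\ n = label d a b].

Lemma chain0 d : chain d 0 = d.
Proof.
by apply/seteqP; split=> [n [//|[a [b []]]]|n dn] //; left.
Qed.

Lemma chain_block d i a b : (a < i)%N -> chain d i (label d a b).
Proof. by move=> ai; right; exists a, b. Qed.

Lemma chain_incr d i n : chain d i.+1 n -> ~ chain d i n ->
  exists b, n = label d i b.
Proof.
move=> [dn|[a [b [ai ->]]]] ni; first by case: ni; left.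
exists b; suff -> : a = i by [].
apply/eqP; rewrite eqn_leq -ltnS ai /= leqNgt; apply/negP => lt_ai.
by apply: ni; exact: chain_block.
Qed.

(** A block is infinite, so it cannot be absorbed by the finite bottom [d']. *)
Lemma chain_sub d d' i i' a : finite_set d -> finite_set d' ->
  chain d i `<=` chain d' i' -> (a < i)%N -> d = d' /\ (a < i')%N.
Proof.
move=> fd fd' sub ai.
have [b nb] : exists b, ~ d' (label d a b).
  apply: contrapT => /forallNP all_d'.
  apply: infinite_nat.
  suff -> : [set: nat] = label d a @^-1` d'.
    by apply: finite_preimage => // x y _ _ /(label_inj fd fd)[].
  by apply/seteqP; split=> // x _; apply: contrapT; exact: all_d'.
by have [//|[a' [b' [a'i' /(label_inj fd fd')[-> -> _]]]]] :=
  sub _ (chain_block d b ai).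
Qed.

(** Were [chain d i.+1] finite, it could serve as the bottom of a chain of
    length 0, which has no block to contain the last block of
    [chain d i.+1]. *)
Lemma chain_infinite d i : finite_set d -> infinite_set (chain d i.+1).
Proof.
move=> fd fc.
have sub : chain d i.+1 `<=` chain (chain d i.+1) 0 by rewrite chain0.
by have [] := chain_sub fd fc sub (ltn0Sn i).
Qed.

Lemma chain_inj d d' i i' : finite_set d -> finite_set d' ->
  chain d i = chain d' i' -> d = d' /\ i = i'.
Proof.
move=> fd fd' eqc.
have sub : chain d i `<=` chain d' i' by rewrite eqc.
have bus : chain d' i' `<=` chain d i by rewrite eqc.
have le_ii' : (i <= i')%N.
  by case: i sub {bus eqc} => // i /(chain_sub fd fd')/(_ (ltnSn i))[].
have le_i'i : (i' <= i)%N.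
  by case: i' bus {sub eqc le_ii'} => // i' /(chain_sub fd' fd)/(_ (ltnSn i'))[].
have eqi : i = i' by apply/eqP; rewrite eqn_leq le_ii'.
subst i'; split=> //; case: i eqc sub {bus le_ii' le_i'i} => [|i _ sub].
  by rewrite !chain0.
by have [] := chain_sub fd fd' sub (ltn0Sn i).
Qed.

(** The step from [chain d i.+1] down to [chain d i], for [d] in [D], is
    written as a removal: openness of the level sets is only threatened by the
    numbers that leave the value at a point. *)
Definition shift_down (D : set (set nat)) (A : set nat) : set nat :=
  A `\` [set n | exists d i, [/\ D d, A = chain d i.+1 & ~ chain d i n]].

Section ShiftDown.
Variable D : set (set nat).
Hypothesis finD : D `<=` finite_set.

Lemma shift_down_chain d i : D d -> shift_down D (chain d i.+1) = chain d i.
Proof.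
move=> Dd; apply/seteqP; split=> [n [cn nn]|n cn].
  by apply: contrapT => ncn; apply: nn; exists d, i.
split=> [|[d' [i' [Dd' eqc]]]].
  case: cn => [dn|[a [b [ai ->]]]]; first by left.
  by apply: chain_block; exact: ltnW.
by have [<- [<-]] := chain_inj (finD Dd) (finD Dd') eqc.
Qed.

Lemma shift_down_id A : (forall d i, D d -> A <> chain d i.+1) ->
  shift_down D A = A.
Proof.
move=> nA; apply/seteqP; split=> [n []//|n An].
by split=> // -[d [i [Dd /nA]]]; exact.
Qed.

Lemma shift_down_inj A B : ~ D A -> ~ D B ->
  shift_down D A = shift_down D B -> A = B.
Proof.
have nchain C : ~ (exists d i, D d /\ C = chain d i.+1) ->
    shift_down D C = C.
  by move=> nC; apply: shift_down_id => d i Dd eC; apply: nC; exists d, i.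
have mixed d i C : D d -> ~ D C ->
    ~ (exists d i, D d /\ C = chain d i.+1) -> chain d i <> C.
  move=> Dd nDC nC; case: i => [|i] eC; last by apply: nC; exists d, i.
  by apply: nDC; rewrite -eC chain0.
move=> nDA nDB.
have [[d [i [Dd ->]]]|nA] := pselect (exists d i, D d /\ A = chain d i.+1);
have [[d' [i' [Dd' ->]]]|nB] := pselect (exists d i, D d /\ B = chain d i.+1).
- rewrite !shift_down_chain // => eqc.
  by have [-> ->] := chain_inj (finD Dd) (finD Dd') eqc.
- by rewrite shift_down_chain // nchain // => /(mixed _ _ _ Dd nDB nB).
- rewrite shift_down_chain // nchain // => /esym.
  by move=> /(mixed _ _ _ Dd' nDA nA).
- by rewrite !nchain.
Qed.

(** A set on a chain, its bottom [d] in [D] included, comes from the next one,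
    which is infinite and so outside [D]; any other set is fixed. *)
Lemma shift_down_surj W : exists2 A,
  shift_down D A = W & ~ D A.
Proof.
have [[d [i [Dd ->]]]|nW] := pselect (exists d i, D d /\ W = chain d i).
  exists (chain d i.+1); first exact: shift_down_chain.
  by move=> /finD; apply: chain_infinite; exact: finD.
exists W; last by move=> DW; apply: nW; exists W, 0%N; rewrite chain0.
by apply: shift_down_id => d i Dd eW; apply: nW; exists d, i.+1.
Qed.

(** A removed [n] belongs to the block of a single step of a single chain. *)
Lemma shift_down_removes A B n : A n -> B n ->
  ~ shift_down D A n -> ~ shift_down D B n -> A = B.
Proof.
have step C : C n -> ~ shift_down D C n ->
    exists d i b, [/\ D d, C = chain d i.+1 & n = label d i b].
  move=> Cn nC; have [d [i [Dd eC ni]]] : exists d i,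
      [/\ D d, C = chain d i.+1 & ~ chain d i n].
    by apply: contrapT => nex; apply: nC.
  have [|b eb] := @chain_incr d i n _ ni; first by rewrite -eC.
  by exists d, i, b.
move=> An Bn /(step _ An)[d [i [b [Dd -> eqn]]]].
move=> /(step _ Bn)[d' [i' [b' [Dd' ->]]]]; rewrite eqn => {}eqn.
by have [-> -> _] := label_inj (finD Dd) (finD Dd') eqn.
Qed.

End ShiftDown.

(** * From an injection missing only finite sets to a bijection *)

(** Shifting down the chains above the missed sets makes [f] bijective, and
    removes a given [n] at one point at most, so each level set loses no more
    than a closed singleton. *)
Lemma UU_of_injection (X : topologicalType) (f : X -> set nat) :
  (forall x : X, closed [set x]) ->
  (forall n, open [set x | f x n]) ->
  injective f ->
  (forall W, infinite_set W -> exists x, f x = W) ->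
  UU X nat.
Proof.
move=> closed1 open_f f_inj f_inf.
pose D : set (set nat) := [set d | ~ exists x, f x = d].
have finD : D `<=` finite_set.
  by move=> d nd; apply: contrapT => /f_inf.
have nD x : ~ D (f x) by move=> /(_ (ex_intro _ x erefl)).
pose U : set (X * nat) := [set p | shift_down D (f p.1) p.2].
have open_slice n : open [set x | shift_down D (f x) n].
  pose E := [set x | f x n /\ ~ shift_down D (f x) n].
  have -> : [set x | shift_down D (f x) n] = [set x | f x n] `&` ~` E.
    apply/seteqP; split=> x /=; first by move=> sx; split; [case: sx|case].
    by move=> [fx nE]; apply: contrapT => nsx; apply: nE.
  apply: openI (open_f n) _; apply: closed_openC.
  have [[x [fx nx]]|noE] := pselect (exists x, E x); last first.
    suff -> : E = set0 by exact: closed0.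
    by apply/seteqP; split=> // x Ex; apply: noE; exists x.
  suff -> : E = [set x] by exact: closed1.
  apply/seteqP; split=> [y [fy ny]|y ->] //.
  exact/f_inj/(shift_down_removes finD fy fx ny nx).
exists U; split.
  rewrite openE => -[x n] Uxn.
  exists ([set y | shift_down D (f y) n], [set n]).
    split; apply: open_nbhs_nbhs; split=> //.
      exact: open_slice.
    exact: discrete_open.
  by move=> [y m] [/= sy ->].
have sectionE x : xsection U x = shift_down D (f x).
  apply/seteqP; split=> n; first by move/xsectionP.
  by move=> ?; apply/xsectionP.
move=> W _.
have [A AW nDA] := shift_down_surj finD W.
have [x fx] : exists x, f x = A by apply: contrapT.
exists x; split=> [|y]; first by rewrite sectionE fx.
rewrite sectionE -AW => /esym /(shift_down_inj finD nDA (@nD y)) eA.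
by apply: f_inj; rewrite fx.
Qed.

(** * Itineraries of the tent map *)

Local Open Scope ring_scope.

Section Tent.
Variable R : realType.
Implicit Types x y : R.

Definition tent x : R := 1 - `|2 * x - 1|.

Lemma tent_continuous : continuous tent.
Proof.
move=> x; apply: cvgB; first exact: cvg_cst.
apply: cvg_norm; apply: cvgB; last exact: cvg_cst.
by apply: cvgM; [exact: cvg_cst|exact: cvg_id].
Qed.

Lemma iter_tent_continuous n : continuous (iter n tent).
Proof.
elim: n => [|n IHn] x; first exact: cvg_id.
exact: (@continuous_comp _ _ _ (iter n tent) tent x (IHn x) (@tent_continuous _)).
Qed.

Lemma tent_low x : x <= 1 / 2 -> tent x = 2 * x.
Proof. by move=> xlow; rewrite /tent ler0_norm; lra. Qed.

Lemma tent_high x : 1 / 2 <= x -> tent x = 2 - 2 * x.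
Proof. by move=> xhigh; rewrite /tent ger0_norm; lra. Qed.

Lemma tent_bound x : 0 <= x <= 1 -> 0 <= tent x <= 1.
Proof.
move=> /andP[x0 x1]; have [xlow|/ltW xhigh] := leP x (1 / 2).
  by rewrite tent_low //; apply/andP; split; lra.
by rewrite tent_high //; apply/andP; split; lra.
Qed.

Lemma iter_tent_bound n x : 0 <= x <= 1 -> 0 <= iter n tent x <= 1.
Proof. by move=> x01; elim: n => //= n; exact: tent_bound. Qed.

Definition tent_itinerary x : set nat := [set n | 1 / 2 < iter n tent x].

(** While two orbits stay on the same side of [1 / 2], their distance doubles
    at every step, yet it never exceeds 1. *)
Lemma tent_itinerary_inj x y : 0 <= x <= 1 -> 0 <= y <= 1 ->
  tent_itinerary x = tent_itinerary y -> x = y.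
Proof.
move=> x01 y01 eqxy.
have dist n : `|iter n tent x - iter n tent y| = 2 ^+ n * `|x - y|.
  elim: n => [|n IHn]; first by rewrite expr0 mul1r.
  rewrite exprS -mulrA -IHn /=.
  have : (1 / 2 < iter n tent x) = (1 / 2 < iter n tent y).
    have : tent_itinerary x n = tent_itinerary y n by rewrite eqxy.
    by rewrite /tent_itinerary /= => /is_true_inj.
  have two : 2 = `|2| :> R by rewrite ger0_norm.
  case: ltP => [/ltW hx /esym/ltW hy|lx /esym/negbT].
    by rewrite !tent_high // [in RHS]two -normrM -normrN; congr `|_|; lra.
  rewrite -leNgt => ly.
  by rewrite !tent_low // [in RHS]two -normrM; congr `|_|; lra.
apply/eqP; rewrite -subr_eq0 -normr_eq0; apply/negP => /negP nz.
have d0 : 0 < `|x - y| by rewrite lt_neqAle eq_sym nz normr_ge0.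
pose n := Num.bound `|x - y|^-1.
have : `|x - y|^-1 < 2 ^+ n.
  apply: (lt_trans (archi_boundP _)); first by rewrite invr_ge0 ltW.
  by rewrite -natrX ltr_nat ltn_expl.
rewrite -[X in X < _]mul1r ltr_pdivrMr // -dist ltNge => /negP; apply.
have /andP[? ?] := iter_tent_bound n x01.
have /andP[? ?] := iter_tent_bound n y01.
by rewrite ler_norml; apply/andP; split; lra.
Qed.

Definition weak_itinerary (W : set nat) x k :=
  (W k -> 1 / 2 <= iter k tent x) /\ (~ W k -> iter k tent x <= 1 / 2).

(** Pull back along the two inverse branches of the tent map. *)
Lemma weak_itinerary_finite n (W : set nat) :
  exists2 x, 0 <= x <= 1 & forall k, (k < n)%N -> weak_itinerary W x k.
Proof.
elim: n W => [|n IHn] W; first by exists 0 => //; rewrite lexx ler01.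
have [y /andP[y0 y1] ywk] := IHn (W \o succn).
suff [x x01 [x_wk tx]] : exists2 x, 0 <= x <= 1 &
    weak_itinerary W x 0 /\ tent x = y.
  exists x => // -[//|k] kn; rewrite /weak_itinerary iterSr tx.
  exact: (ywk k kn).
rewrite /weak_itinerary /=.
have [W0|nW0] := pselect (W 0%N).
- exists (1 - y / 2); first by apply/andP; split; lra.
  by split; [split=> // _; lra|rewrite tent_high; lra].
- exists (y / 2); first by apply/andP; split; lra.
  by split; [split=> // _; lra|rewrite tent_low; lra].
Qed.

Lemma weak_itinerary_closed W k : closed [set x | weak_itinerary W x k].
Proof.
have ck := (continuous_closedP _).1 (@iter_tent_continuous k).
have [Wk|nWk] := pselect (W k).
- suff -> : [set x | weak_itinerary W x k] =
      iter k tent @^-1` [set y | 1 / 2 <= y] by apply: ck; exact: closed_ge.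
  by apply/seteqP; split=> x /=; [case=> /(_ Wk)|move=> ?; split].
- suff -> : [set x | weak_itinerary W x k] =
      iter k tent @^-1` [set y | y <= 1 / 2] by apply: ck; exact: closed_le.
  by apply/seteqP; split=> x /=; [case=> _ /(_ nWk)|move=> ?; split].
Qed.

(** Points following [W] for longer and longer times accumulate in [[0, 1]],
    and the conditions defining a weak itinerary are closed. *)
Lemma weak_itinerary_exists (W : set nat) :
  exists2 x, 0 <= x <= 1 & forall k, weak_itinerary W x k.
Proof.
have [u u01 uwk] : exists2 u : nat -> R, (forall n, 0 <= u n <= 1) &
    forall n k, (k < n)%N -> weak_itinerary W (u n) k.
  have /choice[u uP] : forall n, exists x, 0 <= x <= 1 /\
      forall k, (k < n)%N -> weak_itinerary W x k.
    by move=> n; have [x ? ?] := weak_itinerary_finite n W; exists x.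
  by exists u => n; have [] := uP n.
have [|x [x01 clx]] := @segment_compact R 0 1 (u @ \oo) _.
  by apply: (@nearW _ \oo) => n; rewrite /= in_itv; exact: u01.
exists x; first by move: x01; rewrite /= in_itv.
move=> k; have := @weak_itinerary_closed W k x; apply.
move: clx; rewrite clusterE; apply.
by exists k.+1 => // n /= kn; exact: uwk.
Qed.

(** An orbit through [1 / 2] goes on to 1, then stays at 0: it admits no
    infinite weak itinerary. *)
Lemma tent_itinerary_surj (W : set nat) : infinite_set W ->
  exists2 x, 0 <= x <= 1 & tent_itinerary x = W.
Proof.
move=> infW; have [x x01 xW] := weak_itinerary_exists W.
exists x => //.
have nhalf n : iter n tent x <> 1 / 2.
  move=> half; apply: infW.
  have zero m : iter (m + n.+2) tent x = 0.
    elim: m => [|m IHm].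
      by rewrite add0n !iterS half tent_high // tent_high; lra.
    by rewrite addSn iterS IHm tent_low ?mulr0 //; lra.
  apply: (@sub_finite_set _ _ `I_n.+2); last exact: finite_II.
  move=> k Wk /=; rewrite ltnNge; apply/negP => nk.
  by have := (xW k).1 Wk; rewrite -(subnK nk) zero; lra.
apply/seteqP; split=> n /=; rewrite /tent_itinerary /=.
  move=> hn; apply: contrapT => /(xW n).2; lra.
move=> /(xW n).1 hn; rewrite lt_neqAle hn andbT.
by apply/eqP => /esym; exact: nhalf.
Qed.

End Tent.

(* [nat] carries the library's discrete topology. *)
Theorem theorem3 (R : realType) : UU (unit_interval R) nat.
Proof.
have val01 (x : unit_interval R) : 0 <= set_val x <= 1.
  by have := set_valP x; rewrite /= in_itv.
have cval : continuous (set_val : unit_interval R -> R).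
  exact: initial_continuous.
apply: (@UU_of_injection _ (fun x => tent_itinerary (set_val x))).
- move=> x.
  have -> : [set x] = (set_val : unit_interval R -> R) @^-1` [set set_val x].
    by apply/seteqP; split=> y /= => [->//|/val_inj].
  apply: ((continuous_closedP _).1 cval).
  exact/accessible_closed_set1/hausdorff_accessible/Rhausdorff.
- move=> n.
  have := (continuousP _).1 cval _ ((continuousP _).1
    (@iter_tent_continuous R n) _ (@open_gt R (1 / 2))).
  exact.
- by move=> x y /tent_itinerary_inj eqxy; apply: val_inj; exact: eqxy.
- move=> W /(@tent_itinerary_surj R)[x x01 xW].
  have xI : x \in (`[0, 1]%classic : set R) by apply: mem_set; rewrite /= in_itv.
  by exists (exist _ x xI).
Qed.
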